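(* Let $N\ge1$ and let $\mathbb{A},\mathbb{B}\in\mathbb{C}_{N\times N}$ be constant matrices with $|\mathbb{B}|\neq 0$ and $\mathbb{A}=\mathbb{B}\mathbb{B}^*$. Let $\varphi(x,t)=(\varphi_1,\dots,\varphi_N)^T$ be a vector of $C^\infty$ complex-valued functions of the real variables $x,t$ satisfying $$\varphi_{xx}=\mathbb{A}\varphi,\qquad \varphi_x=\mathbb{B}\varphi^*,\qquad \varphi_t=-4\varphi_{xxx}.$$ Then the Wronskian $f=|\varphi,\partial_x\varphi,\dots,\partial_x^{N-1}\varphi|$ solves the bilinear mKdV equation $$(D_t+D_x^3)\,f^*\cdot f=0,\qquad D_x^2\,f^*\cdot f=0.$$
   Context: Here $^*$ denotes complex conjugation (entrywise for vectors and matrices). Hirota's bilinear operator is defined by $D_x^mD_t^n\,f(x,t)\cdot g(x,t)=(\partial_x-\partial_{x'})^m(\partial_t-\partial_{t'})^n f(x,t)g(x',t')\big|_{x'=x,\,t'=t}$. The Wronskian $|\varphi,\partial_x\varphi,\dots,\partial_x^{N-1}\varphi|$ is the determinant of the $N\times N$ matrix whose $j$-th column is $\partial_x^{j-1}\varphi$. (Via $v=i(\ln(f^*/f))_x$ such $f$ yields solutions of the mKdV equation $v_t+6v^2v_x+v_{xxx}=0$.) *)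

(* Defs.v *)
From HB Require Import structures.
From mathcomp Require Import all_boot all_order all_algebra.
From mathcomp Require Import all_classical all_reals all_analysis.
From mathcomp Require Import complex.
Set Implicit Arguments. Unset Strict Implicit. Unset Printing Implicit Defensive.
Import Order.TTheory GRing.Theory Num.Theory.
Import numFieldNormedType.Exports.
Local Open Scope ring_scope.
Local Open Scope complex_scope.

Section Defs.
Variable R : realType.
Local Notation C := (complex R).

Definition cfun2 := R -> R -> C.

Definition pdx (F : cfun2) : cfun2 := fun x t =>
  Complex (derive1 (fun y => complex.Re (F y t)) x) (derive1 (fun y => complex.Im (F y t)) x).
Definition pdt (F : cfun2) : cfun2 := fun x t =>
  Complex (derive1 (fun s => complex.Re (F x s)) t) (derive1 (fun s => complex.Im (F x s)) t).

Definition cconj (F : cfun2) : cfun2 := fun x t => conjc (F x t).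

Definition pd (i k : nat) (F : cfun2) : cfun2 := iter i pdx (iter k pdt F).

Definition pdword (w : seq bool) (F : cfun2) : cfun2 :=
  foldr (fun b G => if b then pdx G else pdt G) F w.

Definition smooth2 (F : cfun2) : Prop :=
  forall w : seq bool, let G := pdword w F in
    continuous (fun p : R * R => complex.Re (G p.1 p.2)) /\
    continuous (fun p : R * R => complex.Im (G p.1 p.2)) /\
    (forall x t, derivable (fun y => complex.Re (G y t)) x 1 /\
                 derivable (fun y => complex.Im (G y t)) x 1 /\
                 derivable (fun s => complex.Re (G x s)) t 1 /\
                 derivable (fun s => complex.Im (G x s)) t 1).

(* Hirota bilinear operator D_x^m D_t^n f.g, i.e. the expansion of
   (d_x - d_x')^m (d_t - d_t')^n f(x,t) g(x',t') at x'=x, t'=t. *)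
Definition hirota (m n : nat) (f g : cfun2) : cfun2 := fun x t =>
  \sum_(i < m.+1) \sum_(k < n.+1)
    ((-1) ^+ ((m - i) + (n - k)) * ('C(m, i) * 'C(n, k))%:R
      * pd i k f x t * pd (m - i) (n - k) g x t).

Definition wronskian (N : nat) (phi : 'I_N -> cfun2) : cfun2 := fun x t =>
  \det (\matrix_(i < N, j < N) iter j pdx (phi i) x t).

Definition colv (N : nat) (phi : 'I_N -> cfun2) (x t : R) : 'cV[C]_N :=
  \col_(i < N) phi i x t.

End Defs.

(* Main.v *)
(* Write [c_j] for the column of [j]-th x-derivatives of [phi].  All data reduce to
   the numbers [hook k m], the determinant of [c_0, ..., c_(N-1)] with the column
   [c_(N-k)] replaced by [c_(N-k+m)]: up to the sign [(-1)^(k-1)] this is the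
   generalised Wronskian of a hook partition.  The x- and t-derivatives of [f] are
   linear combinations of hooks, and [c_(j+2) = A c_j] yields linear relations with
   coefficient [tr A].  Since [c_(j+1) = B c_j^*], the function [det B * f^*] is the
   Wronskian [g] of the shifted columns [c_1, ..., c_N], so after multiplication by
   [det B] both equations are bilinear identities between hooks of [c] and hooks of
   the shifted columns; they follow from three Pluecker relations and the trace
   relations. *)
Require Import Defs.
From HB Require Import structures.
From mathcomp Require Import all_boot all_order all_algebra perm.
From mathcomp Require Import all_classical all_reals all_analysis.
From mathcomp Require Import complex ring.
Import Order.TTheory GRing.Theory Num.Theory.
Set Implicit Arguments. Unset Strict Implicit.
Local Open Scope ring_scope.

(** * Determinants with one column replaced, and algebraic relations between hooks *)

Section Columns.
Variables (K : comNzRingType) (N : nat).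
Implicit Types (M : 'M[K]_N) (v : 'cV[K]_N) (c : nat -> 'cV[K]_N).

Definition setcol M (j : 'I_N) v : 'M[K]_N :=
  \matrix_(k, l) (if l == j then v k 0 else M k l).

Definition colsmx c : 'M[K]_N := \matrix_(k, l) c l k 0.

(** Laplace expansion along column [j], whose cofactors do not see the replaced entries. It makes
    the determinant linear in [v]. *)
Lemma det_setcol M j v : \det (setcol M j v) = (\adj M *m v) j 0.
Proof.
rewrite (expand_det_col _ j) mxE; apply: eq_bigr => k _.
rewrite !mxE eqxx mulrC; congr (_ * v k 0); rewrite /cofactor; congr (_ * \det _).
by apply/matrixP => a b; rewrite !mxE eq_sym (negbTE (neq_lift _ _)).
Qed.

Lemma setcol_id M j : setcol M j (col j M) = M.
Proof. by apply/matrixP => a b; rewrite !mxE; case: eqP => // ->. Qed.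

Lemma setcol_setcol M j v w : setcol (setcol M j v) j w = setcol M j w.
Proof. by apply/matrixP => a b; rewrite !mxE; case: eqP. Qed.

Lemma det_eq_col M i j : i != j -> col i M = col j M -> \det M = 0.
Proof.
move=> neq_ij eq_ij; rewrite -det_tr; apply: (determinant_alternate neq_ij) => k.
by have /matrixP/(_ k 0) := eq_ij; rewrite !mxE.
Qed.

Lemma det_xcol M i j : i != j -> \det (xcol i j M) = - \det M.
Proof. by move=> ij; rewrite xcolE det_mulmx det_perm odd_tperm ij mulrN1. Qed.

Definition cdet c (i : 'I_N) v : K := \det (setcol (colsmx c) i v).

(* The sum has at most one term, [i = N - k]; it is empty, giving [0], for [k > N]. *)
Definition hook c (k m : nat) : K :=
  \sum_(i < N | (i + k == N)%N) cdet c i (c (i + m)%N).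

Lemma cdetE c i v : cdet c i v = (\adj (colsmx c) *m v) i 0.
Proof. exact: det_setcol. Qed.

Lemma col_colsmx c i : col i (colsmx c) = c i.
Proof. by apply/matrixP => a b; rewrite !mxE [b]ord1. Qed.

Lemma cdet_self c (i : 'I_N) : cdet c i (c i) = \det (colsmx c).
Proof. by rewrite /cdet -(col_colsmx c i) setcol_id. Qed.

Lemma cdet_col c (i : 'I_N) l : (l < N)%N ->
  cdet c i (c l) = if l == i then \det (colsmx c) else 0.
Proof.
move=> ltl; case: eqP => [->|/eqP neq]; first exact: cdet_self.
apply: (@det_eq_col _ i (Ordinal ltl)); first by rewrite eq_sym.
apply/matrixP => a b; rewrite !mxE eqxx /=.
by rewrite (negbTE (_ : Ordinal ltl != i)) // -val_eqE.
Qed.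

(** If [i + m.+1 < N], the inserted column is already present and the determinant vanishes. Only the
    last [m.+1] positions can survive, and each contributes one hook. *)
Lemma sum_hook c m : \sum_(i < N) cdet c i (c (i + m.+1)%N) =
  \sum_(k < m.+1) hook c k.+1 m.+1.
Proof.
rewrite [RHS](exchange_big_dep predT) //=; apply: eq_bigr => i _.
have [ltN|leN] := ltnP (i + m.+1) N.
  rewrite (cdet_col _ _ ltN) -{2}[val i]addn0 eqn_add2l /= big1 // => k /eqP kN.
  by move: ltN; rewrite -{2}kN ltn_add2l ltnNge ltn_ord.
have lt_k : ((N - i).-1 < m.+1)%N.
  by rewrite -ltnS prednK ?subn_gt0 // ltnS leq_subLR.
rewrite (big_pred1 (Ordinal lt_k)) // => k /=.
rewrite -[in RHS]val_eqE /= -[in RHS]eqSS prednK ?subn_gt0 //.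
by rewrite -[in RHS](eqn_add2l i) subnKC // ltnW.
Qed.

(** With [S = colsmx c], replacing each column in turn by [A] times itself sums to the trace of
    [\adj S *m A *m S]; cyclicity and [S *m \adj S = \det S] turn this into the left side. *)
Lemma hook_trace (A : 'M[K]_N) c :
  (forall j, c j.+2 = A *m c j) ->
  \tr A * \det (colsmx c) = hook c 1 2 + hook c 2 2.
Proof.
move=> hc; transitivity (\sum_(i < N) cdet c i (c (i + 2)%N)); last first.
  by rewrite sum_hook !big_ord_recl big_ord0 addr0.
rewrite mulrC -mxtraceZ -mul_mx_scalar -mul_mx_adj mulmxA mxtrace_mulC mulmxA.
apply: eq_bigr => i _; rewrite cdetE addn2 hc mulmxA !mxE.
by apply: eq_bigr => j _; rewrite !mxE.
Qed.

Lemma hook1 c m : (0 < N)%N -> exists i : 'I_N,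
  (i.+1 = N) /\ hook c 1 m = cdet c i (c (i + m)%N).
Proof.
move=> N0; have lt : (N.-1 < N)%N by rewrite prednK.
exists (Ordinal lt); split; first by rewrite /= prednK.
rewrite /hook (big_pred1 (Ordinal lt)) // => i /=.
by rewrite -[in RHS]val_eqE /= -[in RHS]eqSS prednK // addn1.
Qed.

Lemma hook10 c : (0 < N)%N -> hook c 1 0 = \det (colsmx c).
Proof. by move=> N0; have [i [_ ->]] := hook1 c 0 N0; rewrite addn0 cdet_self. Qed.

Lemma hook21 c : hook c 2 1 = 0.
Proof.
rewrite /hook big1 // => i /eqP iN.
rewrite cdet_col; last by rewrite -{2}iN ltn_add2l.
by rewrite -{2}[val i]addn0 eqn_add2l.
Qed.

(* Pluecker relation: apply the linear form [cdet c i] to Cramer's identity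
   [S *m \adj S *m v = \det S *: v], where [S] has the columns shifted by one. *)
Lemma hook_pluecker c k m : (0 < N)%N ->
  let c' j := c j.+1 in
  \det (colsmx c) * hook c' k.+2 (m + k.+1)%N + hook c k.+1 k.+1 * hook c' 1 m
  = \det (colsmx c') * hook c k.+1 (m + k.+1)%N.
Proof.
move=> N0 c'.
have [ltk|lek] := ltnP k N; last first.
  have hook0 d j r : (k < j)%N -> hook d j r = 0.
    move=> ltkj; rewrite /hook big_pred0 // => i; apply: gtn_eqF.
    by rewrite (leq_ltn_trans lek) // (leq_trans ltkj) // leq_addl.
  by rewrite (hook0 c') // !(hook0 c) // mul0r !mulr0 addr0.
have lti : (N - k.+1 < N)%N by rewrite ltn_subrL.
pose i := Ordinal lti.
have hk r : hook c k.+1 r = cdet c i (c (i + r)%N).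
  rewrite /hook (big_pred1 i) // => j /=.
  by rewrite -[in RHS]val_eqE /= -[in RHS](eqn_add2r k.+1) subnK.
have [l [lN hl]] := hook1 c' m N0.
have ik : (i + k.+1 = l.+1)%N by rewrite lN /= subnK.
have -> : hook c' 1 m = cdet c' l (c (l.+1 + m)%N) by rewrite hl.
rewrite !hk [(m + _)%N]addnC addnA ik; set v := c (l.+1 + m)%N.
have -> : \det (colsmx c') * cdet c i v =
    \sum_(j < N) cdet c i (c j.+1) * cdet c' j v.
  transitivity ((\adj (colsmx c) *m (colsmx c' *m (\adj (colsmx c') *m v))) i 0).
    by rewrite (mulmxA (colsmx c')) mul_mx_adj mul_scalar_mx -scalemxAr [RHS]mxE -cdetE.
  rewrite mulmxA [LHS]mxE; apply: eq_bigr => j _; rewrite -cdetE; congr (_ * _).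
  by rewrite cdetE !mxE; apply: eq_bigr => r _; rewrite [colsmx c' r j]mxE.
(* The term [j = l] inserts [c_N], which is not a column of [colsmx c]. Every other [c_(j+1)] is
   one, so only [j.+1 = i] survives; no such [j] exists when [i = 0], and the hook is then an empty
   sum. *)
rewrite (bigD1 l) //= addrC; congr (_ + _).
rewrite /hook big_distrr /= [RHS]big_mkcond [LHS]big_mkcond /=.
apply: eq_bigr => j _.
have [->|neq] := eqVneq j l.
  rewrite gtn_eqF //.
  by rewrite -[X in (X < _)%N]lN !addnS !ltnS leq_addr.
have ltj : (j.+1 < N)%N.
  rewrite ltn_neqAle ltn_ord andbT; apply: contra neq => /eqP jN.
  by rewrite -val_eqE -eqSS jN lN.
rewrite (cdet_col _ _ ltj).
have -> : (j + k.+2 == N)%N = (j.+1 == i).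
  by rewrite -(eqn_add2r k.+1 j.+1 i) ik lN addSnnS.
case: eqP => [ji|]; last by rewrite mul0r.
by congr (_ * cdet c' j _); rewrite /v -ik -ji /c' addnA addSn.
Qed.

(** Shifting a column [j != i] duplicates its right neighbour unless that neighbour is column [i],
    now occupied by [v]. The last column has no neighbour: it is either column [i] itself, or it
    becomes [c_N = v]. This is the role of the two alternatives. *)
Lemma sum_setcol_shift c (i : 'I_N) v : i.+1 = N \/ v = c N ->
  \sum_(j < N | j != i) \det (setcol (setcol (colsmx c) i v) j (c j.+1)) =
  - \sum_(j < N | j.+1 == i) cdet c j v.
Proof.
move=> hiv; rewrite -sumrN big_mkcond [RHS]big_mkcond /=; apply: eq_bigr => j _.
set M := setcol _ _ _.
have Mj : col j M = c j.+1 by apply/matrixP => a b; rewrite !mxE eqxx [b]ord1.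
have Ml (l : 'I_N) : l != j -> col l M = if l == i then v else c l.
  move=> neq; apply/matrixP => a b; rewrite !mxE (negbTE neq) [b]ord1.
  by case: ifP; rewrite ?mxE.
have [->|neq] := eqVneq j i; first by rewrite gtn_eqF.
case: eqP => [ji|/eqP nji].
  (* Column [j] now holds [c_i] and column [i] holds [v]; exchanging them produces the sign. *)
  rewrite /cdet -(det_xcol _ neq); congr (\det _).
  apply/matrixP => a b; rewrite !mxE.
  case: tpermP => [->|->|/eqP nbj /eqP nbi]; rewrite ?eqxx ?(negbTE neq) //.
    by rewrite (eq_sym i) (negbTE neq) ji.
    by rewrite (eq_sym i) (negbTE neq).
  by rewrite (negbTE nbj) (negbTE nbi).
rewrite /=; have [ltj|] := ltnP j.+1 N; last first.
  rewrite leq_eqVlt ltnS [(N <= j)%N]leqNgt ltn_ord orbF => /eqP jN.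
  case: hiv => [iN|vN].
    by case/eqP: neq; apply: val_inj; apply: succn_inj; rewrite iN.
  apply: (det_eq_col neq); rewrite Mj Ml ?eqxx 1?eq_sym //.
  by rewrite vN; congr c; exact: esym.
have nl : Ordinal ltj != j by rewrite -val_eqE /= gtn_eqF.
apply: (det_eq_col nl); rewrite Mj Ml // -val_eqE /= (negbTE nji) //.
Qed.

Lemma hook_reindex c k m : (0 < k)%N ->
  \sum_(i < N | (i + k == N)%N) \sum_(j < N | j.+1 == i) cdet c j (c (i + m)%N) =
  hook c k.+1 m.+1.
Proof.
move=> k0; rewrite (exchange_big_dep (fun j : 'I_N => j + k.+1 == N)%N) /=; last first.
  by move=> i j /eqP iN /eqP ji; rewrite addnS -addSn ji iN.
apply: eq_bigr => j /eqP jN.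
have ltj : (j.+1 < N)%N by rewrite -[X in (_ < X)%N]jN -addn1 ltn_add2l ltnS.
rewrite (big_pred1 (Ordinal ltj)) /= ?addSnnS // => i /=.
rewrite -[in RHS]val_eqE /= [in RHS]eq_sym; case: (j.+1 =P i) => [<-|_]; last by rewrite andbF.
by rewrite addSnnS jN eqxx.
Qed.

End Columns.

(** * Derivatives of complex-valued functions of a real variable, of determinants and of hooks *)

Section ComplexDerivative.
Variable R : realType.
Local Notation C := (complex R).
Implicit Types (F G : R -> C) (x : R) (a b : C).

(** Componentwise, to match [pdx] and [pdt]; the relational form carries differentiability together
    with the value. *)
Definition cderiv F x a :=
  is_derive x 1 (fun y => complex.Re (F y)) (complex.Re a) /\
  is_derive x 1 (fun y => complex.Im (F y)) (complex.Im a).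

Lemma cderiv_cst x a : cderiv (fun=> a) x 0.
Proof. by split; exact: is_derive_cst. Qed.

Lemma cderivD F G x a b :
  cderiv F x a -> cderiv G x b -> cderiv (fun y => F y + G y) x (a + b).
Proof.
move=> [Fr Fi] [Gr Gi]; split.
  rewrite raddfD /=; under eq_fun do rewrite raddfD /=; exact: is_deriveD.
rewrite raddfD /=; under eq_fun do rewrite raddfD /=; exact: is_deriveD.
Qed.

Lemma cderivM F G x a b : cderiv F x a -> cderiv G x b ->
  cderiv (fun y => F y * G y) x (a * G x + F x * b).
Proof.
have ReM (u v : C) : complex.Re (u * v) =
    complex.Re u * complex.Re v - complex.Im u * complex.Im v.
  by case: u; case: v.
have ImM (u v : C) : complex.Im (u * v) =
    complex.Re u * complex.Im v + complex.Im u * complex.Re v.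
  by case: u; case: v.
move=> [Fr Fi] [Gr Gi]; split.
  rewrite raddfD /= !ReM; under eq_fun do rewrite ReM.
  apply: (is_derive_eq (is_deriveB (is_deriveM Fr Gr) (is_deriveM Fi Gi))).
  by rewrite /GRing.scale /=; ring.
rewrite raddfD /= !ImM; under eq_fun do rewrite ImM.
apply: (is_derive_eq (is_deriveD (is_deriveM Fr Gi) (is_deriveM Fi Gr))).
by rewrite /GRing.scale /=; ring.
Qed.

Lemma cderiv_conj F x a : cderiv F x a -> cderiv (fun y => conjc (F y)) x (conjc a).
Proof.
have Reconj (u : C) : complex.Re (conjc u) = complex.Re u by case: u.
have Imconj (u : C) : complex.Im (conjc u) = - complex.Im u by case: u.
move=> [Fr Fi]; split.
  by rewrite Reconj; under eq_fun do rewrite Reconj.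
by rewrite Imconj; under eq_fun do rewrite Imconj; exact: is_deriveN.
Qed.

Lemma cderivZ F x a b : cderiv F x a -> cderiv (fun y => b * F y) x (b * a).
Proof.
by move=> Fa; have := cderivM (cderiv_cst x b) Fa; rewrite mul0r add0r.
Qed.

Lemma cderivN F x a : cderiv F x a -> cderiv (fun y => - F y) x (- a).
Proof.
by move=> /(cderivZ (-1)); rewrite mulN1r; under eq_fun do rewrite mulN1r.
Qed.

Lemma cderivB F G x a b :
  cderiv F x a -> cderiv G x b -> cderiv (fun y => F y - G y) x (a - b).
Proof. by move=> Fa /cderivN; exact: cderivD. Qed.

Lemma cderiv_sum (I : Type) (r : seq I) (P : pred I) (F : I -> R -> C) x (a : I -> C) :
  (forall i, P i -> cderiv (F i) x (a i)) ->
  cderiv (fun y => \sum_(i <- r | P i) F i y) x (\sum_(i <- r | P i) a i).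
Proof.
move=> dF; elim: r => [|i r IHr].
  by rewrite big_nil; under eq_fun do rewrite big_nil; exact: cderiv_cst.
rewrite big_cons; under eq_fun do rewrite big_cons.
by case: ifP => // Pi; apply: cderivD => //; exact: dF.
Qed.

Lemma cderiv_prod n (F : 'I_n -> R -> C) x (a : 'I_n -> C) :
  (forall i, cderiv (F i) x (a i)) ->
  cderiv (fun y => \prod_(i < n) F i y) x
    (\sum_(k < n) \prod_(i < n) (if i == k then a i else F i x)).
Proof.
elim: n F a => [|n IHn] F a dF.
  by rewrite big_ord0; under eq_fun do rewrite big_ord0; exact: cderiv_cst.
under eq_fun do rewrite big_ord_recl.
have := cderivM (dF ord0) (IHn _ _ (fun i => dF (lift ord0 i))).
rewrite big_ord_recl big_ord_recl eqxx mulr_sumr.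
congr (cderiv _ _ (_ * _ + _)); apply: eq_bigr => k _.
by rewrite [RHS]big_ord_recl.
Qed.

Lemma cderiv_det n (M : R -> 'M[C]_n) x (M' : 'M[C]_n) :
  (forall k l, cderiv (fun y => M y k l) x (M' k l)) ->
  cderiv (fun y => \det (M y)) x (\sum_(j < n) \det (setcol (M x) j (col j M'))).
Proof.
move=> dM; rewrite /determinant exchange_big /=.
apply: cderiv_sum => s _; rewrite -mulr_sumr; apply: cderivZ.
have := cderiv_prod (fun i => dM i (s i)).
(* Factor [k] of the product for [s] is the entry [(k, s k)], so differentiating it amounts to
   differentiating column [s k]. *)
congr cderiv; rewrite [RHS](reindex_inj (@perm_inj _ s)); apply: eq_bigr => k _.
by apply: eq_bigr => i _; rewrite !mxE (inj_eq perm_inj); case: eqP => // ->.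
Qed.

Lemma cderiv_unique F x a b : cderiv F x a -> cderiv F x b -> a = b.
Proof.
move=> [Fr Fi] [Gr Gi]; apply/eqP; rewrite eq_complex; apply/andP; split; apply/eqP.
  by rewrite -(@derive_val _ _ _ _ _ _ _ Fr) -(@derive_val _ _ _ _ _ _ _ Gr).
by rewrite -(@derive_val _ _ _ _ _ _ _ Fi) -(@derive_val _ _ _ _ _ _ _ Gi).
Qed.

Section Hook.
Variables (N : nat) (c : R -> nat -> 'cV[C]_N) (x : R).

Lemma cderiv_det_flow (m : nat) (a : C) :
  (forall j k, cderiv (fun y => c y j k 0) x (a * c x (j + m.+1)%N k 0)) ->
  cderiv (fun y => \det (colsmx (c y))) x (a * \sum_(k < m.+1) hook (c x) k.+1 m.+1).
Proof.
move=> dc; rewrite -sum_hook mulr_sumr.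
pose M' : 'M[C]_N := \matrix_(k, l) (a * c x (l + m.+1)%N k 0).
rewrite (_ : \sum_(i < N) _ =
    \sum_(j < N) \det (setcol (colsmx (c x)) j (col j M'))).
  apply: cderiv_det => k l; rewrite mxE; under eq_fun do rewrite mxE.
  exact: dc.
apply: eq_bigr => j _.
rewrite det_setcol cdetE !mxE mulr_sumr; apply: eq_bigr => k _.
by rewrite !mxE mulrCA.
Qed.

Hypothesis dc : forall j k, cderiv (fun y => c y j k 0) x (c x j.+1 k 0).

Lemma cderiv_cdet (i : 'I_N) l : i.+1 = N \/ l = N ->
  cderiv (fun y => cdet (c y) i (c y l)) x
    (cdet (c x) i (c x l.+1) - \sum_(j < N | j.+1 == i) cdet (c x) j (c x l)).
Proof.
move=> hl; rewrite -sum_setcol_shift; last by case: hl => [|->]; [left|right].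
pose M' : 'M[C]_N := \matrix_(k, j) (if j == i then c x l.+1 k 0 else c x j.+1 k 0).
rewrite (_ : _ + _ = \sum_(j < N)
    \det (setcol (setcol (colsmx (c x)) i (c x l)) j (col j M'))).
  apply: cderiv_det => k j; rewrite mxE; under eq_fun do rewrite mxE.
  by case: ifP => // _; under eq_fun do rewrite mxE.
rewrite [RHS](bigD1 i) //=; congr (_ + _).
  rewrite setcol_setcol; congr (\det (setcol _ _ _)).
  by apply/matrixP => a b; rewrite !mxE eqxx [b]ord1.
apply: eq_bigr => j /negbTE nji; congr (\det (setcol _ _ _)).
by apply/matrixP => a b; rewrite !mxE nji [b]ord1.
Qed.

(** Differentiation adds a box to the partition. For one row ([k = 1]) or one column ([k = m]) the
    box can only extend the arm or the leg, so the result stays among hooks; the minus sign comes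
    from the sign convention of [hook]. *)
Lemma cderiv_hook k m : k = 1 \/ k = m -> (0 < k)%N ->
  cderiv (fun y => hook (c y) k m) x (hook (c x) k m.+1 - hook (c x) k.+1 m.+1).
Proof.
move=> km k0; rewrite -(hook_reindex (c x) m k0) -sumrB.
apply: cderiv_sum => i /eqP iN; rewrite addnS; apply: cderiv_cdet.
by case: km => km; [left; move: iN; rewrite km addn1|right; rewrite -km].
Qed.

End Hook.
End ComplexDerivative.

(** * Partial derivatives of functions of [x] and [t] *)

Section Fields.
Variable R : realType.
Local Notation C := (complex R).
Implicit Types (F G : cfun2 R).

Definition dx F G := forall x t, cderiv (fun y => F y t) x (G x t).
Definition dt F G := forall x t, cderiv (fun s => F x s) t (G x t).

Lemma dx_pdx F G : dx F G -> pdx F = G.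
Proof.
move=> dF; apply/funext => x; apply/funext => t; have [Fr Fi] := dF x t.
rewrite /pdx !derive1E (@derive_val _ _ _ _ _ _ _ Fr) (@derive_val _ _ _ _ _ _ _ Fi).
by case: (G x t).
Qed.

Lemma dt_pdt F G : dt F G -> pdt F = G.
Proof.
move=> dF; apply/funext => x; apply/funext => t; have [Fr Fi] := dF x t.
rewrite /pdt !derive1E (@derive_val _ _ _ _ _ _ _ Fr) (@derive_val _ _ _ _ _ _ _ Fi).
by case: (G x t).
Qed.

Lemma dx_unique F G H : dx F G -> dx F H -> G = H.
Proof. by move=> /dx_pdx <- /dx_pdx <-. Qed.

Lemma dt_unique F G H : dt F G -> dt F H -> G = H.
Proof. by move=> /dt_pdt <- /dt_pdt <-. Qed.

Lemma dx_conj F G : dx F G -> dx (cconj F) (cconj G).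
Proof. by move=> dF x t; apply: cderiv_conj. Qed.

Lemma dt_conj F G : dt F G -> dt (cconj F) (cconj G).
Proof. by move=> dF x t; apply: cderiv_conj. Qed.

Lemma smooth2_dx F j : smooth2 F -> dx (iter j (@pdx R) F) (iter j.+1 (@pdx R) F).
Proof.
move=> /(_ (nseq j true)) /=; have -> : pdword (nseq j true) F = iter j (@pdx R) F.
  by elim: j => //= j ->.
move=> [_ [_ dF]] x t; have [/derivableP Fr [/derivableP Fi _]] := dF x t.
by split; rewrite /= ?derive1E.
Qed.

Lemma smooth2_dt F : smooth2 F -> dt F (pdt F).
Proof.
move=> /(_ [::]) /= [_ [_ dF]] x t.
have [_ [_ [/derivableP Fr /derivableP Fi]]] := dF x t.
by split; rewrite /= ?derive1E.
Qed.

(** * Derivatives and trace relations of the determinant of a column sequence with the given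
    flows *)

Section Flow.
Variables (N : nat) (N0 : (0 < N)%N) (A : 'M[C]_N) (c : R -> R -> nat -> 'cV[C]_N).
Hypothesis cx : forall j k, dx (fun x t => c x t j k 0) (fun x t => c x t j.+1 k 0).
Hypothesis ct : forall j k,
  dt (fun x t => c x t j k 0) (fun x t => - 4%:R * c x t (j + 3)%N k 0).
Hypothesis cA : forall x t j, c x t j.+2 = A *m c x t j.

Let f x t := \det (colsmx (c x t)).
Let q k m x t := hook (c x t) k m.

Lemma flow_fx : dx f (q 1 1).
Proof.
move=> x t; have := @cderiv_hook _ _ (c^~ t) x (fun j k => cx j k x t) 1 0 (or_introl erefl) isT.
(* The determinant is the hook [1 0]; the leg term [2 1] of its derivative has a repeated column. *)
by rewrite hook21 subr0; under eq_fun do rewrite hook10 //.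
Qed.

Lemma flow_q1x m : dx (q 1 m) (fun x t => q 1 m.+1 x t - q 2 m.+1 x t).
Proof.
by move=> x t; apply: (@cderiv_hook _ _ (c^~ t) x (fun j k => cx j k x t)) => //; left.
Qed.

Lemma flow_q22x : dx (q 2 2) (fun x t => q 2 3 x t - q 3 3 x t).
Proof.
by move=> x t; apply: (@cderiv_hook _ _ (c^~ t) x (fun j k => cx j k x t)) => //; right.
Qed.

Lemma flow_fxxx : dx (fun x t => q 1 2 x t - q 2 2 x t)
  (fun x t => q 1 3 x t - q 2 3 x t - (q 2 3 x t - q 3 3 x t)).
Proof. by move=> x t; apply: cderivB; [exact: flow_q1x|exact: flow_q22x]. Qed.

Lemma flow_ft : dt f (fun x t => - 4%:R * (q 1 3 x t + (q 2 3 x t + q 3 3 x t))).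
Proof.
move=> x t.
(* The shift by 3 in [ct] is [m.+1] with [m = 2]. *)
have := @cderiv_det_flow _ _ (c x) t 2 (- 4%:R) (fun j k => ct j k x t).
by rewrite !big_ord_recl big_ord0 addr0.
Qed.

Lemma flow_tr x t : \tr A * f x t = q 1 2 x t + q 2 2 x t.
Proof. by apply: hook_trace => j; exact: cA. Qed.

(** This is the x-derivative of [flow_tr], in which the two occurrences of [q 2 3] cancel. *)
Lemma flow_trx x t : \tr A * q 1 1 x t = q 1 3 x t - q 3 3 x t.
Proof.
have dl : dx (fun x t => \tr A * f x t) (fun x t => \tr A * q 1 1 x t).
  by move=> y s; apply: cderivZ; exact: flow_fx.
have dr : dx (fun x t => \tr A * f x t)
    (fun x t => q 1 3 x t - q 2 3 x t + (q 2 3 x t - q 3 3 x t)).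
  move=> y s; under eq_fun do rewrite flow_tr.
  by apply: cderivD; [exact: flow_q1x|exact: flow_q22x].
have /(congr1 (fun G : cfun2 R => G x t)) /= -> := dx_unique dl dr.
by rewrite addrA subrK.
Qed.

End Flow.

End Fields.

(** * Explicit low-order Hirota derivatives *)

Section HirotaSum.
Variables (K : comNzRingType) (u v : nat -> nat -> K).
(** The body of [hirota] with arbitrary families in place of the partial derivatives, so that the
    expansion is pure ring algebra. *)
Let hsum (m n : nat) := \sum_(i < m.+1) \sum_(k < n.+1)
  ((-1) ^+ ((m - i) + (n - k)) * ('C(m, i) * 'C(n, k))%:R
    * u i k * v (m - i)%N (n - k)%N).

Let natE := (erefl : bump 0 0 = 1%N, erefl : bump 0 1 = 2%N, erefl : bump 0 2 = 3%N,
  subSS, subn0, subnn, bin0, bin1, binn, erefl : 'C(3, 2) = 3%N).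

Lemma hirota_sum01 : hsum 0 1 = u 0%N 1%N * v 0%N 0%N - u 0%N 0%N * v 0%N 1%N.
Proof. by rewrite /hsum !big_ord_recl !big_ord0 /= !natE; ring. Qed.

Lemma hirota_sum20 : hsum 2 0 =
  u 2%N 0%N * v 0%N 0%N - 2%:R * (u 1%N 0%N * v 1%N 0%N) + u 0%N 0%N * v 2%N 0%N.
Proof. by rewrite /hsum !big_ord_recl !big_ord0 /= !natE; ring. Qed.

Lemma hirota_sum30 : hsum 3 0 =
  u 3%N 0%N * v 0%N 0%N - 3%:R * (u 2%N 0%N * v 1%N 0%N)
  + 3%:R * (u 1%N 0%N * v 2%N 0%N) - u 0%N 0%N * v 3%N 0%N.
Proof. by rewrite /hsum !big_ord_recl !big_ord0 /= !natE; ring. Qed.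

End HirotaSum.


Section Hirota.
Variables (R : realType) (F F1 F2 G G1 G2 : cfun2 R) (x t : R).
Let jet (H : cfun2 R) (i k : nat) := pd i k H x t.

Lemma hirota01E Ft Gt : dt F Ft -> dt G Gt ->
  hirota 0 1 F G x t = Ft x t * G x t - F x t * Gt x t.
Proof. by move=> /dt_pdt <- /dt_pdt <-; exact: (hirota_sum01 (jet F) (jet G)). Qed.

Hypotheses (dF : dx F F1) (dF1 : dx F1 F2) (dG : dx G G1) (dG1 : dx G1 G2).

Lemma hirota20E :
  hirota 2 0 F G x t = F2 x t * G x t - 2%:R * (F1 x t * G1 x t) + F x t * G2 x t.
Proof.
rewrite -(dx_pdx dF1) -(dx_pdx dF) -(dx_pdx dG1) -(dx_pdx dG).
exact: (hirota_sum20 (jet F) (jet G)).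
Qed.

Lemma hirota30E F3 G3 : dx F2 F3 -> dx G2 G3 ->
  hirota 3 0 F G x t = F3 x t * G x t - 3%:R * (F2 x t * G1 x t)
    + 3%:R * (F1 x t * G2 x t) - F x t * G3 x t.
Proof.
move=> dF2 dG2; rewrite -(dx_pdx dF2) -(dx_pdx dF1) -(dx_pdx dF).
rewrite -(dx_pdx dG2) -(dx_pdx dG1) -(dx_pdx dG).
exact: (hirota_sum30 (jet F) (jet G)).
Qed.

End Hirota.

(** Here [d] is [\det B], [T] is [\tr A], and [u], [u1], [u2], [u3], [ut] are [f^*] and its
    derivatives. The letters [h1], [h2], [h3] stand for the hooks [1 m], and [s], [b], [e] for
    [2 2], [2 3], [3 3]; [g] and the primed letters belong to the shifted columns. Cancelling [d]
    leaves identities between hooks. *)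
Lemma bilinear_mkdv_algebra (K : idomainType) (d T : K)
    (f h1 h2 h3 s b e g h1' h2' h3' s' b' e' u u1 u2 u3 ut : K) :
  d != 0 -> d * u = g -> d * u1 = h1' -> d * u2 = h2' - s' ->
  d * u3 = h3' - b' - (b' - e') -> d * ut = - 4%:R * (h3' + (b' + e')) ->
  T * f = h2 + s -> T * h1 = h3 - e -> T * g = h2' + s' -> T * h1' = h3' - e' ->
  f * s' + h1 * h1' = g * h2 -> f * b' + h1 * h2' = g * h3 ->
  f * e' + s * h1' = g * b ->
  ut * f - u * (- 4%:R * (h3 + (b + e))) +
    (u3 * f - 3%:R * (u2 * h1) + 3%:R * (u1 * (h2 - s))
     - u * (h3 - b - (b - e))) = 0 /\
  u2 * f - 2%:R * (u1 * h1) + u * (h2 - s) = 0.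
Proof.
move=> d0 ug u1g u2g u3g utg Tf Th1 Tg Th1' P1 P2 P3.
split; apply: (mulfI d0); rewrite mulr0.
  transitivity (d * ut * f - d * u * (- 4%:R * (h3 + (b + e))) +
    (d * u3 * f - 3%:R * (d * u2 * h1) + 3%:R * (d * u1 * (h2 - s))
     - d * u * (h3 - b - (b - e)))); first by ring.
  rewrite ug u1g u2g u3g utg.
  (* The inner differences vanish by [P2] and [P3]. By the trace relations the rest is [T] times
     [- f * h1' - g * h1 + h1 * g + h1' * f], which is zero. *)
  transitivity (3%:R * (2%:R * (g * h3 - (f * b' + h1 * h2'))
    + 2%:R * (g * b - (f * e' + s * h1')) - f * (h3' - e') - g * (h3 - e)
    + h1 * (h2' + s') + h1' * (h2 + s))); first by ring.
  by rewrite P2 P3 -Tf -Th1 -Tg -Th1'; ring.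
transitivity (d * u2 * f - 2%:R * (d * u1 * h1) + d * u * (h2 - s)); first by ring.
rewrite ug u1g u2g.
(* The difference vanishes by [P1], and the trace terms are [T * g * f] and [g * T * f]. *)
transitivity ((h2' + s') * f - g * (h2 + s)
  + 2%:R * (g * h2 - (f * s' + h1 * h1'))); first by ring.
by rewrite P1 -Tf -Tg; ring.
Qed.

(** * The bilinear equations for the Wronskian *)

Theorem theorem4p2p1 (R : realType) (N : nat) (hN : (1 <= N)%N)
  (A B : 'M[complex R]_N) (phi : 'I_N -> cfun2 R)
  (hB : \det B != 0)
  (hA : A = B *m map_mx (@conjc R) B)
  (hsmooth : forall i, smooth2 (phi i))
  (hxx : forall x t, colv (fun i => pdx (pdx (phi i))) x t = A *m colv phi x t)
  (hx : forall x t, colv (fun i => pdx (phi i)) x t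
                    = B *m map_mx (@conjc R) (colv phi x t))
  (ht : forall x t, colv (fun i => pdt (phi i)) x t
                    = - 4%:R *: colv (fun i => pdx (pdx (pdx (phi i)))) x t) :
  let f := wronskian phi in
  forall x t : R,
    hirota 0 1 (cconj f) f x t + hirota 3 0 (cconj f) f x t = 0 /\
    hirota 2 0 (cconj f) f x t = 0.
Proof.
move=> f.
pose c x t j := colv (fun i => iter j (@pdx R) (phi i)) x t.
have cx j k : dx (fun x t => c x t j k 0) (fun x t => c x t j.+1 k 0).
  move=> x t; rewrite mxE; under eq_fun do rewrite mxE; exact: smooth2_dx.
(* Differentiating the relation for [j] in [x] gives the one for [j.+1], since [B] is constant. *)
have cB j x t : c x t j.+1 = B *m map_mx (@conjc R) (c x t j).
  elim: j x t => [|j IHj] x t; first exact: hx.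
  apply/matrixP => k l; rewrite [l]ord1.
  have dB : dx (fun x t => c x t j.+1 k 0)
      (fun x t => (B *m map_mx (@conjc R) (c x t j.+1)) k 0).
    move=> y s; under eq_fun do rewrite IHj mxE; rewrite mxE.
    apply: cderiv_sum => i _; apply: cderivZ; rewrite mxE.
    by under eq_fun do rewrite mxE; apply: cderiv_conj; exact: cx.
  by have /(congr1 (fun G : cfun2 R => G x t)) := dx_unique (cx j.+1 k) dB.
(* The induction goes through [cB], so x- and t-derivatives are never exchanged; it uses that [-4]
   is real and thus fixed by conjugation. *)
have ct j k : dt (fun x t => c x t j k 0) (fun x t => - 4%:R * c x t (j + 3)%N k 0).
  elim: j k => [|j IHj] k x t.
    have /matrixP/(_ k 0) := ht x t; rewrite !mxE => <-.
    under eq_fun do rewrite mxE; exact: (smooth2_dt (hsmooth k) x t).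
  under eq_fun do rewrite cB mxE; rewrite addSn cB mxE mulr_sumr.
  apply: cderiv_sum => i _; rewrite mulrCA; apply: cderivZ.
  under eq_fun do rewrite mxE; rewrite mxE.
  have -> : - 4%:R * conjc (c x t (j + 3)%N i 0) =
      conjc (- 4%:R * c x t (j + 3)%N i 0).
    by rewrite rmorphM rmorphN rmorph_nat.
  exact: cderiv_conj (IHj i x t).
have cA x t j : c x t j.+2 = A *m c x t j.
  rewrite !cB map_mxM mulmxA hA; congr (_ *m _).
  by apply/matrixP => a b; rewrite !mxE; exact: conjcK.
(* The shifted columns obey the same three relations, so every flow lemma applies to them too. *)
pose c' x t j := c x t j.+1.
have cx' j k : dx (fun x t => c' x t j k 0) (fun x t => c' x t j.+1 k 0) by exact: cx.
have ct' j k : dt (fun x t => c' x t j k 0) (fun x t => - 4%:R * c' x t (j + 3)%N k 0).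
  exact: ct.
have cA' x t j : c' x t j.+2 = A *m c' x t j by exact: cA.
have fE : f = fun x t => \det (colsmx (c x t)).
  apply/funext => x; apply/funext => t; congr (\det _).
  by apply/matrixP => k j; rewrite !mxE.
have fg : (fun x t => \det B * cconj f x t) = fun x t => \det (colsmx (c' x t)).
  apply/funext => x; apply/funext => t; rewrite fE /cconj -det_map_mx -det_mulmx.
  congr (\det _); apply/matrixP => k j; rewrite [RHS]mxE /c' cB !mxE.
  by apply: eq_bigr => i _; rewrite !mxE.
have fx := flow_fx hN cx; rewrite -fE in fx.
have fxx := flow_q1x cx 1.
have fxxx := flow_fxxx cx.
have ft := flow_ft ct; rewrite -fE in ft.
have gx := flow_fx hN cx'; rewrite -fg in gx.
have gxx := flow_q1x cx' 1.
have gxxx := flow_fxxx cx'.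
have gt := flow_ft ct'; rewrite -fg in gt.
have dxZ F G : dx F G -> dx (fun x t => \det B * F x t) (fun x t => \det B * G x t).
  by move=> dF x t; apply: cderivZ.
have dtZ F G : dt F G -> dt (fun x t => \det B * F x t) (fun x t => \det B * G x t).
  by move=> dF x t; apply: cderivZ.
(* Both sides of [fg] are differentiated repeatedly; uniqueness of derivatives identifies [\det B]
   times each derivative of [f^*] with a hook expression in the shifted columns. *)
have e1 := dx_unique (dxZ _ _ (dx_conj fx)) gx.
have et := dt_unique (dtZ _ _ (dt_conj ft)) gt.
rewrite -e1 in gxx; have e2 := dx_unique (dxZ _ _ (dx_conj fxx)) gxx.
rewrite -e2 in gxxx; have e3 := dx_unique (dxZ _ _ (dx_conj fxxx)) gxxx.
move=> x t.
rewrite (hirota01E _ _ (dt_conj ft) ft).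
rewrite (hirota20E _ _ (dx_conj fx) (dx_conj fxx) fx fxx).
rewrite (hirota30E _ _ (dx_conj fx) (dx_conj fxx) fx fxx (dx_conj fxxx) fxxx).
pose at_xt (H : cfun2 R) := H x t.
apply: (bilinear_mkdv_algebra (T := \tr A) hB (congr1 at_xt fg) (congr1 at_xt e1)
  (congr1 at_xt e2) (congr1 at_xt e3) (congr1 at_xt et)).
- by rewrite fE; exact: (flow_tr cA).
- exact: (flow_trx hN cx cA).
- exact: (flow_tr cA').
- exact: (flow_trx hN cx' cA').
- by rewrite fE; exact: (hook_pluecker (c x t) 0 1 hN).
- by rewrite fE; exact: (hook_pluecker (c x t) 0 2 hN).
- by rewrite fE; exact: (hook_pluecker (c x t) 1 1 hN).
Qed.
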